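(* Let $q$ be a prime power with $q\equiv 1\pmod 4$, let $\alpha\in\mathrm{GF}(q^2)\setminus\{0\}$ and $\beta\in\mathrm{GF}(q^2)\setminus\mathrm{GF}(q)$ with $4\alpha^{q+1}+(\beta^q-\beta)^2\neq 0$, and let $\mathcal M_{\alpha,\beta}$ be the corresponding BM quasi-Hermitian variety of $\mathrm{PG}(3,q^2)$. Then the collinearity graph $\Gamma(\mathcal M_{\alpha,\beta})$ is connected and its diameter is $3$.
   Context: Let $(J,X,Y,Z)$ be homogeneous coordinates of $\mathrm{PG}(3,q^2)$ and let $\Sigma_\infty$ be the plane $J=0$. Let $\mathcal B_{\alpha,\beta}$ be the set of points of $\mathrm{PG}(3,q^2)$ satisfying \[Z^qJ^q-ZJ^{2q-1}+\alpha^q(X^{2q}+Y^{2q})-\alpha(X^2+Y^2)J^{2q-2}=(\beta^q-\beta)(X^{q+1}+Y^{q+1})J^{q-1},\] let $\mathcal F=\{(0,X,Y,Z): X^{q+1}+Y^{q+1}=0\}\subset\Sigma_\infty$, and define the BM quasi-Hermitian variety \[\mathcal M_{\alpha,\beta}:=(\mathcal B_{\alpha,\beta}\setminus\Sigma_\infty)\cup\mathcal F .\] For a set $\mathcal V$ of points of a projective space, the collinearity graph $\Gamma(\mathcal V)$ is the graph whose vertices are the points of $\mathcal V$, two distinct points $P,Q$ being adjacent if and only if the projective line through $P$ and $Q$ is entirely contained in $\mathcal V$. *)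

(* Defs.v *)
From HB Require Import structures.
From mathcomp Require Import all_boot all_order all_algebra.

Set Implicit Arguments.
Unset Strict Implicit.
Unset Printing Implicit Defensive.

Import GRing.Theory.
Local Open Scope ring_scope.

Definition prime_power (q : nat) : Prop :=
  exists p k : nat, [/\ prime p, (0 < k)%N & q = (p ^ k)%N].

Section Graph.
Variables (T : finType) (e : rel T).

Definition connected_graph : Prop := forall x y : T, connect e x y.

(* [path e x w] is a walk from [x] to [last x w] using [size w] edges. *)
Definition is_distance (x y : T) (d : nat) : Prop :=
  (exists w : seq T, [/\ path e x w, last x w = y & size w = d]) /\
  (forall w : seq T, path e x w -> last x w = y -> (d <= size w)%N).

Definition is_diameter (d : nat) : Prop :=
  (forall x y : T, exists2 k : nat, is_distance x y k & (k <= d)%N) /\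
  (exists x y : T, is_distance x y d).

End Graph.

Section ProjectiveSpace.
Variables (F : finFieldType) (n : nat).

(* PG(n, F): the one-dimensional subspaces of F^(n+1). *)
Record point := Point {
  pt_space :> {vspace 'rV[F]_n.+1};
  _ : \dim pt_space == 1%N
}.

HB.instance Definition _ := [isSub for pt_space].
HB.instance Definition _ := [Choice of point by <:].

(* A subspace of a finite vector space is determined by its finite set of
   vectors, which makes [point] a finType. *)
Definition set_of_point (P : point) : {set 'rV[F]_n.+1} :=
  [set v | v \in pt_space P].
Definition point_of_set (A : {set 'rV[F]_n.+1}) : option point :=
  insub <<enum A>>%VS.

Lemma set_of_pointK : pcancel set_of_point point_of_set.
Proof.
move=> P; rewrite /point_of_set.
have -> : <<enum (set_of_point P)>>%VS = P :> {vspace _}.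
  apply/eqP; rewrite eqEsubv; apply/andP; split.
    by apply/span_subvP => v; rewrite mem_enum inE.
  by apply/subvP => v vP; apply: memv_span; rewrite mem_enum inE.
by rewrite valK.
Qed.

HB.instance Definition _ := PCanIsCountable set_of_pointK.
HB.instance Definition _ : isFinite point := PCanIsFinite set_of_pointK.

Definition line (P Q : point) : {set point} :=
  [set R : point | (pt_space R <= pt_space P + pt_space Q)%VS].

(* The vertex type is the subtype of the points of [V]. *)
Definition collinearity (V : {set point}) : rel {P : point | P \in V} :=
  fun P Q => (P != Q) && (line (val P) (val Q) \subset V).

(* The locus of a homogeneous condition on coordinate vectors: the condition is
   asked of every vector of homogeneous coordinates of the point, which for a
   homogeneous condition is the same as asking it of one of them. *)
Definition locus (C : pred 'rV[F]_n.+1) : {set point} :=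
  [set P : point | [forall v, (v \in pt_space P) && (v != 0) ==> C v]].

End ProjectiveSpace.

Arguments collinearity {F n} V.

Section BM.
Variables (F : finFieldType) (q : nat) (alpha beta : F).

(* The entries 0, 1, 2, 3 of a row vector are the coordinates J, X, Y, Z. *)
Definition BM_equation (v : 'rV[F]_4) : bool :=
  let J := v 0 0 in let X := v 0 1 in let Y := v 0 2 in let Z := v 0 3 in
  Z ^+ q * J ^+ q - Z * J ^+ (2 * q - 1)
    + alpha ^+ q * (X ^+ (2 * q) + Y ^+ (2 * q))
    - alpha * (X ^+ 2 + Y ^+ 2) * J ^+ (2 * q - 2)
  == (beta ^+ q - beta) * (X ^+ (q + 1) + Y ^+ (q + 1)) * J ^+ (q - 1).

Definition BM_locus : {set point F 3} := locus BM_equation.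

Definition plane_at_infinity : {set point F 3} :=
  locus (fun v : 'rV[F]_4 => v 0 0 == 0).

Definition BM_infinity : {set point F 3} :=
  [set P in plane_at_infinity |
    P \in locus (fun v : 'rV[F]_4 => v 0 1 ^+ (q + 1) + v 0 2 ^+ (q + 1) == 0)].

Definition BM_variety : {set point F 3} :=
  (BM_locus :\: plane_at_infinity) :|: BM_infinity.

End BM.

(* Main.v *)
Require Import Defs.
From HB Require Import structures.
From mathcomp Require Import all_boot all_order all_algebra all_field.
From mathcomp Require Import ring zify.

Set Implicit Arguments.
Unset Strict Implicit.
Unset Printing Implicit Defensive.

Import GRing.Theory.
Local Open Scope ring_scope.

(* Let e be a square root of -1; since q = 1 mod 4, e lies in GF(q).  With
   u = y + ex and v = y - ex, an affine point (1, x, y, z) lies on the variety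
   iff 2z - v c(u) lies in GF(q), where c(u) = -2 alpha u + (beta - beta^q) u^q,
   and also iff 2z - u c(v) does.  Hence every affine point is on two lines of
   the variety, with directions (0, e, 1, c(u)) and (0, -e, 1, c(v)).  Two affine
   points with the same u are collinear with a common point at infinity;
   otherwise a line with v constant can be chosen that meets the lines with u
   constant through both, because w |-> (beta - beta^q)(w d^q - d w^q) maps
   GF(q^2) onto GF(q) for d <> 0.  Points at infinity are joined through
   (0, 0, 0, 1).  This gives distance at most 3.

   Conversely, restricting the equation to an affine line and comparing the
   coefficients of t^2 shows that a line of the variety with direction
   (0, a, b, d) satisfies a^2 + b^2 = 0.  If a^(q+1) = -1 and a^2 <> -1, the point
   (0, a, 1, 0) is thus only on the line joining it to (0, 0, 0, 1), and the
   latter is on no affine line of the variety: the distance from (0, a, 1, 0) to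
   (1, 0, 0, 0) is 3. *)

(** * Walks, distance and diameter in a finite graph *)

Section Walks.
Variables (T : finType) (e : rel T).

Lemma is_distance_min (x y : T) (w : seq T) :
  path e x w -> last x w = y -> exists2 k, is_distance e x y k & (k <= size w)%N.
Proof.
elim: {w}_.+1 {-2}w (ltnSn (size w)) => // n IHn w ltwn ew lw.
have [/existsP[t /andP[et /eqP lt]] | /existsPn no_walk] :=
  boolP [exists t : (size w).-tuple T, path e x t && (last x t == y)]; last first.
  by have := no_walk (in_tuple w); rewrite ew lw eqxx.
have [/existsP[m /existsP[s /andP[es /eqP ls]]] | /existsPn minw] :=
  boolP [exists m : 'I_(size w), exists s : m.-tuple T,
           path e x s && (last x s == y)].
  have ltsw: (size s < size w)%N by rewrite size_tuple.
  have [k dk lek] := IHn s (leq_trans ltsw ltwn) es ls.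
  by exists k => //; rewrite (leq_trans lek) // ltnW.
exists (size w) => //; split; first by exists w.
move=> s es ls; rewrite leqNgt; apply/negP => ltsw.
have /existsPn/(_ (in_tuple s)) := minw (Ordinal ltsw).
by rewrite es ls eqxx.
Qed.

Lemma walk_of_steps (x x1 x2 y : T) :
    (x == x1) || e x x1 -> (x1 == x2) || e x1 x2 -> (x2 == y) || e x2 y ->
  exists w, [/\ path e x w, last x w = y & (size w <= 3)%N].
Proof.
case/orP=> [/eqP<-|e1]; case/orP=> [/eqP<-|e2]; case/orP=> [/eqP<-|e3].
- by exists [::].
- by exists [:: y]; rewrite /= e3.
- by exists [:: x2]; rewrite /= e2.
- by exists [:: x2; y]; rewrite /= e2 e3.
- by exists [:: x1]; rewrite /= e1.
- by exists [:: x1; y]; rewrite /= e1 e3.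
- by exists [:: x1; x2]; rewrite /= e1 e2.
- by exists [:: x1; x2; y]; rewrite /= e1 e2 e3.
Qed.

(** Each of the three steps may be an equality, so coinciding points need no separate treatment. The
    second hypothesis rules out walks with at most two edges. *)
Lemma diameter3 :
    (forall x y, exists x1 x2,
       [/\ (x == x1) || e x x1, (x1 == x2) || e x1 x2 & (x2 == y) || e x2 y]) ->
    (exists x y, [/\ x != y, ~~ e x y & forall s, ~~ (e x s && e s y)]) ->
  connected_graph e /\ is_diameter e 3.
Proof.
move=> up low.
have walk x y : exists w, [/\ path e x w, last x w = y & (size w <= 3)%N].
  by have [x1 [x2 [e1 e2 e3]]] := up x y; apply: walk_of_steps e1 e2 e3.
split=> [x y|]; first by have [w [ew <- _]] := walk x y; apply/connectP; exists w.
split=> [x y|].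
  have [w [ew lw sw]] := walk x y; have [k dk lek] := is_distance_min ew lw.
  by exists k => //; apply: leq_trans lek sw.
have [x [y [neq nexy no2]]] := low; exists x, y.
have dist3 w : path e x w -> last x w = y -> (3 <= size w)%N.
  case: w => [|a [|b [|c w]]] //=.
  - by move=> _ xy; rewrite xy eqxx in neq.
  - by rewrite andbT => exa ay; rewrite -ay exa in nexy.
  - by case/and3P=> exa eab _ bc; have := no2 a; rewrite exa -bc eab.
split=> //; have [w [ew lw sw]] := walk x y; exists w; split=> //.
by apply/eqP; rewrite eqn_leq sw dist3.
Qed.

End Walks.

(** * Points, lines and loci described by spanning vectors *)

Section Points.
Variables (F : finFieldType) (n : nat).
Implicit Types (v w : 'rV[F]_n.+1) (P Q R : point F n).

Lemma dim_vline1 v : v != 0 -> \dim <[v]> == 1%N.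
Proof. by rewrite dim_vline => ->. Qed.

Definition vpoint v (nzv : v != 0) : point F n := Point (dim_vline1 nzv).

Lemma point_vline P v : v \in pt_space P -> v != 0 -> pt_space P = <[v]>%VS.
Proof.
move=> vP nzv; apply/eqP; rewrite eq_sym eqEdim -memvE vP dim_vline nzv.
by case: P {vP} => ? /= /eqP->.
Qed.

Lemma point_vector P : exists2 v, v != 0 & pt_space P = <[v]>%VS.
Proof.
have nzP: vpick P != 0.
  by rewrite vpick0 -dimv_eq0; case: (P) => ? /= /eqP->.
by exists (vpick P) => //; apply: point_vline nzP; apply: memv_pick.
Qed.

Lemma line_sym P Q : line P Q = line Q P.
Proof. by apply/setP=> R; rewrite !inE addvC. Qed.

Lemma mem_line_l P Q : P \in line P Q.
Proof. by rewrite inE addvSl. Qed.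

Lemma mem_line_r P Q : Q \in line P Q.
Proof. by rewrite line_sym mem_line_l. Qed.

Lemma line_subset P Q R S : R \in line P Q -> S \in line P Q ->
  line R S \subset line P Q.
Proof.
rewrite !inE => RPQ SPQ; apply/subsetP=> T; rewrite !inE => /subv_trans-> //.
by rewrite subv_add RPQ.
Qed.

Definition homogeneous (C : pred 'rV[F]_n.+1) :=
  forall k v, k != 0 -> C (k *: v) = C v.

Lemma mem_locus (C : pred 'rV[F]_n.+1) P v : homogeneous C ->
  v != 0 -> pt_space P = <[v]>%VS -> (P \in locus C) = C v.
Proof.
move=> hC nzv PE; rewrite inE; apply/forallP/idP=> [/(_ v)|Cv w].
  by rewrite PE memv_line nzv.
apply/implyP; rewrite PE => /andP[/vlineP[k ->]].
by rewrite scaler_eq0 negb_or => /andP[nzk _]; rewrite hC.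
Qed.

Lemma line_locusP (C : pred 'rV[F]_n.+1) P Q v w : homogeneous C ->
    v != 0 -> w != 0 -> pt_space P = <[v]>%VS -> pt_space Q = <[w]>%VS ->
  reflect (forall a b, a *: v + b *: w != 0 -> C (a *: v + b *: w))
          (line P Q \subset locus C).
Proof.
move=> hC nzv nzw PE QE; apply: (iffP subsetP) => [sPQ a b nzab | Cab R].
  rewrite -(mem_locus (P := vpoint nzab)) //; apply: sPQ.
  by rewrite inE PE QE -memvE memv_add // memvZ // memv_line.
have [u nzu RE] := point_vector R.
rewrite inE RE PE QE -memvE => /memv_addP[_ /vlineP[a ->] [_ /vlineP[b ->] uE]].
by rewrite (mem_locus hC nzu RE) uE Cab // -uE.
Qed.

End Points.

(** * Coordinate vectors of length four *)

Section Row4.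
Variable F : fieldType.

Definition row4 (a b c d : F) : 'rV[F]_4 := \row_j [:: a; b; c; d]`_j.

Lemma row4E a b c d :
  ((row4 a b c d 0 0 = a) * (row4 a b c d 0 1 = b) *
   (row4 a b c d 0 2 = c) * (row4 a b c d 0 3 = d))%type.
Proof. by rewrite !mxE. Qed.

Lemma row4P (v w : 'rV[F]_4) : v 0 0 = w 0 0 -> v 0 1 = w 0 1 ->
  v 0 2 = w 0 2 -> v 0 3 = w 0 3 -> v = w.
Proof.
move=> h0 h1 h2 h3; apply/rowP=> -[[|[|[|[|//]]]] lt_i].
- by move: h0; congr (_ = _); congr (_ _ _); apply: val_inj.
- by move: h1; congr (_ = _); congr (_ _ _); apply: val_inj.
- by move: h2; congr (_ = _); congr (_ _ _); apply: val_inj.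
- by move: h3; congr (_ = _); congr (_ _ _); apply: val_inj.
Qed.

Lemma row4_eta (v : 'rV[F]_4) : v = row4 (v 0 0) (v 0 1) (v 0 2) (v 0 3).
Proof. by apply: row4P; rewrite row4E. Qed.

Lemma row4_comb s t a b c d a' b' c' d' :
  s *: row4 a b c d + t *: row4 a' b' c' d' =
  row4 (s * a + t * a') (s * b + t * b') (s * c + t * c') (s * d + t * d').
Proof. by apply: row4P; rewrite !row4E mxE !(mxE, row4E). Qed.

Lemma row4_eq0 a b c d :
  (row4 a b c d == 0) = [&& a == 0, b == 0, c == 0 & d == 0].
Proof.
apply/eqP/and4P=> [h | [/eqP-> /eqP-> /eqP-> /eqP->]]; last first.
  by apply: row4P; rewrite row4E mxE.
have h' (j : 'I_4) : row4 a b c d 0 j = 0 by rewrite h mxE.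
by move: (h' 0) (h' 1) (h' 2) (h' 3); rewrite !row4E => -> -> -> ->.
Qed.

End Row4.

Section BM.
Variables (q : nat) (F : finFieldType) (alpha beta : F).
Hypotheses (q_pp : prime_power q) (q_mod4 : q = 1 %[mod 4]).
Hypothesis cardF : #|F| = (q ^ 2)%N.

(** * The Frobenius map and special elements of GF(q^2) *)

Lemma q_gt4 : (4 < q)%N.
Proof.
have [p [[|k] [pr_p // _ qE]]] := q_pp.
have: (1 < q)%N by rewrite qE -(exp1n k.+1) ltn_exp2r // prime_gt1.
by move: q_mod4; lia.
Qed.

Lemma q_pchar :
  exists p k : nat, [/\ prime p, p \in [pchar F], (0 < k)%N & q = (p ^ k)%N].
Proof.
have [p [k [pr_p k_gt0 qE]]] := q_pp; exists p, k; split=> //.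
by apply: (@card_finPcharP _ _ (k * 2)); rewrite // cardF qE expnM.
Qed.

Lemma frobD (x y : F) : (x + y) ^+ q = x ^+ q + y ^+ q.
Proof.
have [p [k [pr_p charF k_gt0 qE]]] := q_pchar.
rewrite exprDn_pchar // qE pnatX; apply/orP; left.
by rewrite pnatE.
Qed.

Lemma frob0 : 0 ^+ q = 0 :> F.
Proof. by rewrite expr0n; case: q q_gt4. Qed.

Lemma frobN (x : F) : (- x) ^+ q = - x ^+ q.
Proof. by apply/eqP; rewrite -addr_eq0 -frobD addNr frob0. Qed.

Lemma frobB (x y : F) : (x - y) ^+ q = x ^+ q - y ^+ q.
Proof. by rewrite frobD frobN. Qed.

Lemma frob2 : 2 ^+ q = 2 :> F.
Proof. by rewrite frobD expr1n. Qed.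

Lemma frobK (x : F) : (x ^+ q) ^+ q = x.
Proof. by rewrite -exprM mulnn -cardF expf_card. Qed.

Lemma two_neq0 : 2 != 0 :> F.
Proof.
have [p [k [pr_p charF k_gt0 qE]]] := q_pchar.
rewrite -(dvdn_pcharf charF) dvdn_prime2 //.
apply/eqP => p2; move: q_mod4; rewrite qE p2 -(prednK k_gt0) expnS.
by lia.
Qed.

Lemma exists_neq_root (p : {poly F}) : p != 0 -> (size p <= q ^ 2)%N ->
  exists x, p.[x] != 0.
Proof.
move=> nzp szp; have [/existsP // | /existsPn rootp] := boolP [exists x, p.[x] != 0].
have := max_poly_roots nzp (rs := enum F).
rewrite enum_uniq -cardE cardF => lt_sz.
have: (q ^ 2 < size p)%N.
  by apply: lt_sz => //; apply/allP=> x _; have := rootp x; rewrite negbK.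
by rewrite ltnNge szp.
Qed.

Lemma exists_expn_neq1 m : (0 < m)%N -> (m < (q ^ 2).-1)%N ->
  exists2 x : F, x != 0 & x ^+ m != 1.
Proof.
(* The factor ['X] excludes the witness 0, and the degree [m + 1] stays below [q ^ 2]. *)
move=> m_gt0 lt_m; pose p : {poly F} := ('X^m - 1) * 'X.
have nzXm : ('X^m - 1 : {poly F}) != 0 by rewrite -size_poly_eq0 size_XnsubC.
have [|x] := @exists_neq_root p (mulf_neq0 nzXm (negbT (polyX_eq0 _))).
  by rewrite size_mulX // size_XnsubC //; lia.
rewrite !(hornerE, hornerXn) mulf_eq0 negb_or subr_eq0 => /andP[xm nzx].
by exists x.
Qed.

Lemma expf_pred (x : F) : x != 0 -> x ^+ (q ^ 2).-1 = 1.
Proof.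
move=> nzx; apply: (mulfI nzx); rewrite -exprS prednK ?expn_gt0; last first.
  by case: q q_gt4.
by rewrite -cardF expf_card mulr1.
Qed.

(** With [4 * k = q ^ 2 - 1] and [w ^+ (2 * k) != 1], the element [w ^+ k] squares to -1. It is
    fixed by Frobenius since its fourth power is 1 and [q] is 1 modulo 4. *)
Lemma exists_sqrtN1 : exists2 e : F, e ^+ 2 = -1 & e ^+ q = e.
Proof.
have lt4q := q_gt4; pose k := ((q ^ 2).-1 %/ 4)%N.
have q2E : (q ^ 2).-1 = (k * 4)%N by rewrite /k; move: q_mod4; nia.
have [||w nzw w1] := @exists_expn_neq1 (k * 2)%N; [by nia.. |].
have eE : (w ^+ k) ^+ 2 = -1.
  rewrite -exprM; apply/eqP; have := expf_pred nzw.
  rewrite q2E -[4%N]/(2 * 2)%N mulnA exprM => /eqP.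
  by rewrite sqrf_eq1 (negPf w1).
exists (w ^+ k) => //.
have -> : q = (2 * (2 * (q %/ 4))).+1 by move: q_mod4; lia.
by rewrite exprS exprM eE exprM sqrrN !expr1n mulr1.
Qed.

(** The factor [w ^+ (q - 1)] has norm 1, so it preserves the norm -1 of [e], but [w] is chosen so
    that it changes the square. *)
Lemma exists_other_norm :
  exists a : F, a ^+ (q + 1) = -1 /\ a ^+ 2 != -1.
Proof.
have lt4q := q_gt4; have [e e2 eq] := exists_sqrtN1.
have [||w nzw w1] := @exists_expn_neq1 ((q - 1) * 2)%N; [by nia.. |].
exists (e * w ^+ (q - 1)); split.
  rewrite exprMn exprD eq -expr2 e2 -exprM.
  by rewrite (_ : (_ * _)%N = (q ^ 2).-1) ?expf_pred ?mulr1 //; nia.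
by rewrite exprMn e2 -exprM mulN1r eqr_opp.
Qed.

(* For [e ^+ 2 = -1], put [u := y + e * x] and [v := y - e * x].  Then
   [x ^+ 2 + y ^+ 2 = u * v], and [c u] is the slope of z along the line of the
   variety through (1, x, y, z) on which [u] is constant. *)
Let c u := - 2 * alpha * u + (beta - beta ^+ q) * u ^+ q.

(** The difference of the two sides on the right is twice that of the defining equation: the cross
    terms [e * (x ^+ q * y - x * y ^+ q)] cancel because Frobenius negates [beta - beta ^+ q]. *)
Lemma BM_equation_affineE e x y z : e ^+ 2 = -1 -> e ^+ q = e ->
  BM_equation q alpha beta (row4 1 x y z) =
  ((2 * z - (y - e * x) * c (y + e * x)) ^+ q
    == 2 * z - (y - e * x) * c (y + e * x)).
Proof.
move=> e2 eq; rewrite /BM_equation !row4E /c !expr1n !mulr1.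
rewrite !(mulnC 2 q) !exprM !addn1 !exprSr.
rewrite !(frobD, frobN, exprMn, frob2, frobK, eq) expr1n -subr_eq0.
rewrite -(inj_eq (mulfI two_neq0)) mulr0 -[RHS]subr_eq0; congr (_ == 0).
move: (x ^+ q) (y ^+ q) (z ^+ q) (alpha ^+ q) (beta ^+ q) => X Y Z A B.
by ring: e2.
Qed.

(** * The variety as the locus of one homogeneous condition *)

Lemma homogeneous_BM_equation : homogeneous (BM_equation q alpha beta).
Proof.
move=> k v nzk; rewrite /BM_equation !mxE -subr_eq0 -[RHS]subr_eq0.
rewrite -[RHS](inj_eq (mulfI (expf_neq0 (2 * q) nzk))) mulr0 => {nzk}.
(* All monomials have degree [2 * q]; writing [q] as [m.+1] removes the truncated subtractions from
   the exponents. *)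
case: q q_gt4 => // m _; have -> : (2 * m.+1 - 1 = m + m.+1)%N by lia.
have -> : (2 * m.+1 - 2 = m + m)%N by lia.
rewrite mul2n -addnn subn1 addn1 /= !exprMn !(exprD, exprS).
by congr (_ == 0); ring.
Qed.

(** Merging the affine part and the part at infinity into one predicate makes [line_locusP]
    applicable to the whole variety. *)
Definition BM_cone (v : 'rV[F]_4) : bool :=
  if v 0 0 == 0 then v 0 1 ^+ (q + 1) + v 0 2 ^+ (q + 1) == 0
  else BM_equation q alpha beta v.

Lemma homogeneous_BM_cone : homogeneous BM_cone.
Proof.
move=> k v nzk; rewrite /BM_cone homogeneous_BM_equation // !mxE mulf_eq0.
rewrite (negPf nzk) /=; case: ifP => // _.
by rewrite !exprMn -mulrDr mulf_eq0 expf_eq0 (negPf nzk) andbF.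
Qed.

Lemma BM_varietyE : BM_variety q alpha beta = locus BM_cone.
Proof.
apply/setP=> P; have [v nzv PE] := point_vector P.
have homJ : homogeneous (fun v : 'rV[F]_4 => v 0 0 == 0).
  by move=> k w nzk; rewrite mxE mulf_eq0 (negPf nzk).
have homN : homogeneous
    (fun v : 'rV[F]_4 => v 0 1 ^+ (q + 1) + v 0 2 ^+ (q + 1) == 0).
  move=> k w nzk; rewrite !mxE !exprMn -mulrDr mulf_eq0 expf_eq0.
  by rewrite (negPf nzk) andbF.
rewrite (mem_locus homogeneous_BM_cone nzv PE) inE [in RHS]/BM_cone.
rewrite in_setD [P \in BM_infinity _ _]inE.
rewrite (mem_locus homogeneous_BM_equation nzv PE).
rewrite (mem_locus homJ nzv PE) (mem_locus homN nzv PE).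
by case: ifP; rewrite ?orbF.
Qed.

Local Notation M := (BM_variety q alpha beta).

Lemma line_of_direction P Q v w : v != 0 -> w != 0 ->
    pt_space P = <[v]>%VS -> pt_space Q = <[w]>%VS ->
    BM_cone w -> (forall t, BM_cone (v + t *: w)) ->
  line P Q \subset M.
Proof.
move=> nzv nzw PE QE Cw Cvw; rewrite BM_varietyE.
apply/(line_locusP homogeneous_BM_cone nzv nzw PE QE) => a b.
have [-> | nza _] := eqVneq a 0.
  rewrite scale0r add0r scaler_eq0 negb_or => /andP[nzb _].
  by rewrite homogeneous_BM_cone.
have -> : a *: v + b *: w = a *: (v + (b / a) *: w).
  by rewrite scalerDr scalerA mulrC divfK.
by rewrite homogeneous_BM_cone.
Qed.

Lemma affine_neq0 (x y z : F) : row4 1 x y z != 0.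
Proof. by rewrite row4_eq0 oner_eq0. Qed.

Lemma direction_neq0 (e d : F) : row4 0 e 1 d != 0.
Proof. by rewrite row4_eq0 oner_eq0 !andbF. Qed.

Lemma apex_neq0 : row4 0 0 0 (1 : F) != 0.
Proof. by rewrite row4_eq0 oner_eq0 !andbF. Qed.

Definition affine_pt x y z : point F 3 := vpoint (affine_neq0 x y z).
Definition direction_pt e d : point F 3 := vpoint (direction_neq0 e d).
Definition apex : point F 3 := vpoint apex_neq0.

Variant BM_point_spec (P : point F 3) : Prop :=
  | BM_affine x y z of P = affine_pt x y z & BM_equation q alpha beta (row4 1 x y z)
  | BM_at_infinity a b c (nzv : row4 0 a b c != 0) of P = vpoint nzv &
      a ^+ (q + 1) + b ^+ (q + 1) = 0.

Lemma BM_pointP P : P \in M -> BM_point_spec P.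
Proof.
have [v nzv PE] := point_vector P.
rewrite BM_varietyE (mem_locus homogeneous_BM_cone nzv PE).
have [v0 | nzv0] := eqVneq (v 0 0) 0.
  have vE : v = row4 0 (v 0 1) (v 0 2) (v 0 3) by rewrite -v0 -row4_eta.
  rewrite /BM_cone v0 eqxx => /eqP normv; rewrite vE in nzv.
  apply: (@BM_at_infinity P _ _ _ nzv) => //.
  by apply: val_inj; rewrite /= PE -vE.
rewrite -(homogeneous_BM_cone v (invr_neq0 nzv0)).
pose w := (v 0 0)^-1 *: v; rewrite -/w.
have wE : w = row4 1 (w 0 1) (w 0 2) (w 0 3).
  by rewrite [LHS]row4_eta; congr row4; rewrite mxE mulVf.
rewrite /BM_cone [in w 0 0]wE row4E oner_eq0 wE => Mw.
apply: BM_affine Mw; apply: val_inj; rewrite /= -wE.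
apply: point_vline; last by rewrite scaler_eq0 negb_or invr_neq0.
by rewrite PE memvZ // memv_line.
Qed.

(** * Lines of the variety and the upper bound on distances *)

Lemma direction_apex_line (P : point F 3) a b d (nzv : row4 0 a b d != 0) :
  P = vpoint nzv -> a ^+ (q + 1) + b ^+ (q + 1) = 0 -> line P apex \subset M.
Proof.
move=> -> ab; have q1 : (0 < q + 1)%N by rewrite addn1.
apply: (line_of_direction nzv apex_neq0) => //= [|t].
  by rewrite /BM_cone !row4E eqxx expr0n addn1 addr0.
rewrite -[row4 0 a b d]scale1r row4_comb /BM_cone !row4E !mulr0 !addr0 eqxx.
by rewrite !mul1r ab.
Qed.

Lemma c_additive u v : c (u - v) = c u - c v.
Proof. by rewrite /c frobB; ring. Qed.

(** Moving by [t] fixes [u] and adds [2 * t] to [v], so the changes of [2 * z] and of [v * c u]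
    cancel. *)
Lemma affine_direction_line e x y z : e ^+ 2 = -1 -> e ^+ q = e ->
    BM_equation q alpha beta (row4 1 x y z) ->
  line (affine_pt x y z) (direction_pt e (c (y + e * x))) \subset M.
Proof.
move=> e2 eq Mxyz.
apply: (line_of_direction (affine_neq0 _ _ _) (direction_neq0 _ _)) => // [|t].
  by rewrite /BM_cone !row4E eqxx exprD eq -expr2 e2 expr1n addNr.
rewrite -[row4 1 x y z]scale1r row4_comb /BM_cone !row4E mulr0 addr0 mulr1.
rewrite oner_eq0 !mul1r (BM_equation_affineE _ _ _ e2 eq).
have -> : y + t * 1 + e * (x + t * e) = y + e * x by ring: e2.
have -> : 2 * (z + t * c (y + e * x)) -
    (y + t * 1 - e * (x + t * e)) * c (y + e * x) =
    2 * z - (y - e * x) * c (y + e * x) by ring: e2.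
by rewrite -BM_equation_affineE.
Qed.

Lemma mem_affine_line e d t x y z x' y' z' :
    x' = x + t * e -> y' = y + t -> z' = z + t * d ->
  affine_pt x' y' z' \in line (affine_pt x y z) (direction_pt e d).
Proof.
move=> -> -> ->; rewrite inE /= -memvE.
have -> : row4 1 (x + t * e) (y + t) (z + t * d) =
    row4 1 x y z + t *: row4 0 e 1 d.
  by rewrite -[row4 1 x y z]scale1r row4_comb !mul1r mulr1 mulr0 addr0.
by rewrite memv_add ?memv_line // memvZ // memv_line.
Qed.

Lemma affine_pair_line (x y z x' y' z' e : F) :
    e ^+ 2 = -1 -> e ^+ q = e -> beta ^+ q != beta ->
    BM_equation q alpha beta (row4 1 x y z) ->
    BM_equation q alpha beta (row4 1 x' y' z') ->
    y + e * x != y' + e * x' ->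
  exists X Y, [/\ X \in line (affine_pt x y z) (direction_pt e (c (y + e * x))),
    Y \in line (affine_pt x' y' z') (direction_pt e (c (y' + e * x'))) &
    line X Y \subset M].
Proof.
move=> e2 eq nz_beta Mz Mz' neq_u.
(* Replacing [e] by [- e] exchanges [u] and [v], which gives the second family of lines. *)
have e2' : (- e) ^+ 2 = -1 by rewrite sqrrN.
have eq' : (- e) ^+ q = - e by rewrite frobN eq.
have nz2 := two_neq0.
set u := y + e * x in neq_u *; set u' := y' + e * x' in neq_u *.
pose v := y - e * x; pose v' := y' - e * x'.
have nzd : u - u' != 0 by rewrite subr_eq0.
pose eta := beta - beta ^+ q.
have nzeta : eta != 0 by rewrite subr_eq0 eq_sym.
pose K := v * c u - v' * c u' - 2 * (z - z').
have Kq : K ^+ q = K.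
  have -> : K = (2 * z' - v' * c u') - (2 * z - v * c u) by rewrite /K; ring.
  rewrite frobB; congr (_ - _); apply/eqP.
    by rewrite -(BM_equation_affineE x' y' z' e2 eq).
  by rewrite -(BM_equation_affineE x y z e2 eq).
(* [X] and [Y] will have the same value [w] of the coordinate [v]; they lie on a
   common line of the direction [- e] iff [w * c d - d * c w = K] for
   [d := u - u'], i.e. [eta * (w * d ^+ q - d * w ^+ q) = K].  This is solvable
   since [K ^+ q = K] and [eta ^+ q = - eta]. *)
pose w := K / (2 * eta * (u - u') ^+ q).
have etaq : eta ^+ q = - eta by rewrite frobB frobK opprB.
have wq : w ^+ q = - (K / (2 * eta * (u - u'))).
  rewrite /w exprMn exprVn !exprMn Kq frob2 etaq frobK.
  by field; rewrite oppr_eq0 nz2 nzeta nzd.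
have crossK : w * (c u - c u') - (u - u') * c w = K.
  have nzdq : (u - u') ^+ q != 0 by rewrite expf_neq0.
  rewrite -c_additive /c wq /w -/eta; move: nzd nzdq.
  move: (u - u') ((u - u') ^+ q) => d dq nzd' nzdq.
  by field; rewrite nz2 nzeta nzd' nzdq.
(* The shifts [t] and [t'] bring the coordinate [v] of both points to [w]; the shift [s] along [- e]
   then changes [u] into [u']. *)
pose t := (w - v) / 2; pose t' := (w - v') / 2; pose s := (u' - u) / 2.
exists (affine_pt (x + t * e) (y + t) (z + t * c u)).
exists (affine_pt (x' + t' * e) (y' + t') (z' + t' * c u')).
split; [exact: mem_affine_line | exact: mem_affine_line |].
set X := affine_pt _ _ _; set Y := affine_pt _ _ _.
have wE : w = y + t + - e * (x + t * e).
  by rewrite /t /v; field: e2.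
have MX : BM_equation q alpha beta (row4 1 (x + t * e) (y + t) (z + t * c u)).
  rewrite (BM_equation_affineE _ _ _ e2 eq).
  have -> : y + t + e * (x + t * e) = u by rewrite /u; ring: e2.
  rewrite (_ : _ - _ = 2 * z - v * c u); last by rewrite /v; ring: e2.
  by rewrite -(BM_equation_affineE x y z e2 eq).
apply: subset_trans (affine_direction_line e2' eq' MX).
rewrite -wE; apply: line_subset (mem_line_l _ _) _.
apply: (@mem_affine_line _ _ s).
- by rewrite /s /t /t' /v /v' /u /u'; field: e2.
- by rewrite /s /t /t' /v /v' /u /u'; field.
(* Only the equality of the [z] coordinates uses [crossK]. *)
- apply: (mulfI nz2); apply/eqP; rewrite -subr_eq0 -(subrr K) -{2}crossK.
  by apply/eqP; rewrite /K /s /t /t'; field.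
Qed.

Lemma BM_three_lines P Q : beta ^+ q != beta -> P \in M -> Q \in M ->
  exists X Y, [/\ line P X \subset M, line X Y \subset M & line Y Q \subset M].
Proof.
move=> nz_beta MP MQ; have [e e2 eq] := exists_sqrtN1.
have norm_e : e ^+ (q + 1) + 1 ^+ (q + 1) = 0.
  by rewrite exprD eq -expr2 e2 expr1n addNr.
have to_apex d : line (direction_pt e d) apex \subset M.
  exact: direction_apex_line (erefl _) norm_e.
case: (BM_pointP MP) => [x y z -> Mz | a b d nzv PE normP];
  case: (BM_pointP MQ) => [x' y' z' -> Mz' | a' b' d' nzv' QE normQ].
- have AX := affine_direction_line e2 eq Mz.
  have AY := affine_direction_line e2 eq Mz'.
  have [uu' | neq_u] := eqVneq (y + e * x) (y' + e * x').
    exists (direction_pt e (c (y + e * x))), (direction_pt e (c (y + e * x))).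
    split=> //; last by rewrite line_sym uu'.
    by apply: subset_trans AX; apply: line_subset; apply: mem_line_r.
  have [X [Y [PX QY XY]]] := affine_pair_line e2 eq nz_beta Mz Mz' neq_u.
  exists X, Y; split=> //.
    by apply: subset_trans AX; apply: line_subset PX; apply: mem_line_l.
  by apply: subset_trans AY; apply: line_subset QY _; apply: mem_line_l.
- exists (direction_pt e (c (y + e * x))), apex; split=> //.
    exact: affine_direction_line.
  by rewrite line_sym; apply: direction_apex_line QE normQ.
- exists apex, (direction_pt e (c (y' + e * x'))); split.
  + exact: direction_apex_line PE normP.
  + by rewrite line_sym.
  + by rewrite line_sym; apply: affine_direction_line.
- exists apex, apex; split; first exact: direction_apex_line PE normP.
    (* The line from the apex to itself is a single point, contained in any line of the variety
       through the apex; the direction 0 is an arbitrary choice. *)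
    by apply: subset_trans (to_apex 0); apply: line_subset; apply: mem_line_r.
  by rewrite line_sym; apply: direction_apex_line QE normQ.
Qed.

(** * Constraints on lines of the variety and two points at distance 3 *)

(** Since [4 < q], the exponents 0, 1, 2, [q], [2 * q] are distinct and below [q ^ 2], so a
    polynomial vanishing everywhere has zero coefficients. *)
Lemma frob_poly_eq0 (k0 k1 k2 k3 k4 : F) :
    (forall t, k0 + k1 * t + k2 * t ^+ 2 + k3 * t ^+ q + k4 * (t ^+ q) ^+ 2 = 0) ->
  k1 = 0 /\ k2 = 0.
Proof.
move=> k_eq0; have lt4q := q_gt4.
pose p : {poly F} :=
  k0%:P + k1 *: 'X + k2 *: 'X^2 + k3 *: 'X^q + k4 *: 'X^(q * 2).
have p0 : p = 0.
  apply/eqP; apply/negPn/negP => nzp; have [|t /negP[]] := exists_neq_root nzp.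
    suff le_sz : (size p <= (q * 2).+1)%N by apply: leq_trans le_sz _; nia.
    apply/leq_sizeP => j lt_j; rewrite !coefE.
    by do 5![case: eqP => [?|_]; first lia]; rewrite !mulr0 !addr0.
  by rewrite !(hornerD, hornerZ, hornerC, hornerX, hornerXn) exprM k_eq0.
have coefp0 i : p`_i = 0 by rewrite p0 coef0.
split; [move: (coefp0 1%N) | move: (coefp0 2)]; rewrite !coefE /=;
  do ?[case: eqP => [?|_]; first lia];
  by rewrite ?(mulr0, mulr1, addr0, add0r).
Qed.

Lemma BM_line_cone v w (nzv : v != 0) (nzw : w != 0) :
    line (vpoint nzv) (vpoint nzw) \subset M ->
  forall a b, a *: v + b *: w != 0 -> BM_cone (a *: v + b *: w).
Proof.
rewrite BM_varietyE => /line_locusP; apply => //.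
exact: homogeneous_BM_cone.
Qed.

(** The direction lies at infinity on the variety, which kills the term in [t ^+ (q + 1)]; the
    coefficient of [t ^+ 2] is then [- (alpha * A)]. *)
Lemma affine_line_direction (x y z a b d : F) (nzv : row4 0 a b d != 0) :
    alpha != 0 -> line (affine_pt x y z) (vpoint nzv) \subset M ->
  [/\ a ^+ (q + 1) + b ^+ (q + 1) = 0, a ^+ 2 + b ^+ 2 = 0 & (a != 0) || (b != 0)].
Proof.
move=> nz_alpha /BM_line_cone Mline.
have norm_ab : a ^+ (q + 1) + b ^+ (q + 1) = 0.
  have := Mline 0 1; rewrite scale0r add0r scale1r => /(_ nzv).
  by rewrite /BM_cone !row4E eqxx => /eqP.
have Mt t : BM_equation q alpha beta (row4 1 (x + t * a) (y + t * b) (z + t * d)).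
  have := Mline 1 t; rewrite row4_comb !(mul1r, mulr0, addr0) affine_neq0.
  by move=> /(_ isT); rewrite /BM_cone !row4E oner_eq0.
pose A := a ^+ 2 + b ^+ 2; pose g := beta ^+ q - beta.
have [] := @frob_poly_eq0
    (z ^+ q - z + alpha ^+ q * ((x ^+ q) ^+ 2 + (y ^+ q) ^+ 2)
      - alpha * (x ^+ 2 + y ^+ 2) - g * (x ^+ q * x + y ^+ q * y))
    (- d - 2 * alpha * (x * a + y * b) - g * (x ^+ q * a + y ^+ q * b))
    (- (alpha * A))
    (d ^+ q + 2 * alpha ^+ q * (x ^+ q * a ^+ q + y ^+ q * b ^+ q)
      - g * (a ^+ q * x + b ^+ q * y))
    (alpha ^+ q * ((a ^+ q) ^+ 2 + (b ^+ q) ^+ 2)).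
  move=> t; have := Mt t; rewrite /BM_equation !row4E !expr1n !mulr1.
  rewrite !(mulnC 2 q) !exprM !addn1 !exprSr !(frobD, exprMn) -subr_eq0.
  move=> /eqP Mt0; rewrite -[RHS]Mt0 /A /g.
  move/eqP: norm_ab; rewrite addn1 !exprSr addr_eq0 => /eqP norm_ab.
  by ring: norm_ab.
move=> k1 /eqP; rewrite oppr_eq0 mulf_eq0 (negPf nz_alpha) => /eqP A0.
(* If [a] and [b] vanish, the coefficient of [t] reduces to [- d], and the direction vector would be
   zero. *)
split=> //; apply: contraNT nzv; rewrite negb_or !negbK => /andP[/eqP a0 /eqP b0].
move: k1; rewrite a0 b0 !mulr0 !addr0 !mulr0 !subr0 => /eqP.
by rewrite oppr_eq0 row4_eq0 !eqxx.
Qed.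

(** This is the coefficient of [t] in the Hermitian form along the line: collinear points at
    infinity are orthogonal. *)
Lemma infinite_line_direction (a b d a' b' d' : F)
    (nzv : row4 0 a b d != 0) (nzv' : row4 0 a' b' d' != 0) :
    a' ^+ (q + 1) + b' ^+ (q + 1) = 0 ->
    line (vpoint nzv) (vpoint nzv') \subset M ->
  a ^+ q * a' + b ^+ q * b' = 0.
Proof.
move=> norm' /BM_line_cone Mline.
have Mt t : (a + t * a') ^+ (q + 1) + (b + t * b') ^+ (q + 1) = 0.
  have := Mline 1 t; rewrite row4_comb !(mul1r, mulr0, addr0) => Mt.
  have [/eqP | nzt] := eqVneq (row4 0 (a + t * a') (b + t * b') (d + t * d')) 0.
    rewrite row4_eq0 => /and4P[_ /eqP-> /eqP-> _].
    by rewrite expr0n addn1 addr0.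
  by move: (Mt nzt); rewrite /BM_cone !row4E eqxx => /eqP.
have [|//] := @frob_poly_eq0 (a ^+ q * a + b ^+ q * b)
  (a ^+ q * a' + b ^+ q * b') 0 (a' ^+ q * a + b' ^+ q * b) 0.
move=> t; rewrite -[RHS](Mt t); move/eqP: norm'.
rewrite !addn1 !exprSr !(frobD, exprMn) addr_eq0 => /eqP norm'.
by ring: norm'.
Qed.

Lemma BM_far_points : alpha != 0 -> exists P Q : point F 3,
  [/\ P \in M, Q \in M, P != Q, ~~ (line P Q \subset M) &
    forall S, S \in M -> ~~ ((line P S \subset M) && (line S Q \subset M))].
Proof.
move=> nz_alpha; have [a [norm_a nza2]] := exists_other_norm.
have [e e2 eq] := exists_sqrtN1.
have q_gt0 : (0 < q)%N by apply: leq_trans q_gt4.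
have M0 : BM_equation q alpha beta (row4 1 0 0 0).
  rewrite (BM_equation_affineE _ _ _ e2 eq) /c !(mulr0, addr0, subr0) frob0.
  by rewrite !mulr0 addr0 mulr0 subr0 frob0.
have lineQ := affine_direction_line e2 eq M0.
have MP : line (direction_pt a 0) apex \subset M.
  apply: direction_apex_line (erefl _) _; by rewrite norm_a expr1n addNr.
have no_affine x y z : ~~ (line (direction_pt a 0) (affine_pt x y z) \subset M).
  apply/negP; rewrite line_sym => /(affine_line_direction nz_alpha)[_ /eqP + _].
  by rewrite expr1n addr_eq0 (negPf nza2).
exists (direction_pt a 0), (affine_pt 0 0 0); split=> //.
- exact: (subsetP MP _ (mem_line_l _ _)).
- exact: (subsetP lineQ _ (mem_line_l _ _)).
(* If the points coincided, their line would be one point of [lineQ], contrary to [no_affine]. *)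
- apply: contraNneq (no_affine 0 0 0) => ->; apply: subset_trans lineQ.
  by apply: line_subset; apply: mem_line_l.
move=> S MS; apply/negP => /andP[PS SQ].
case: (BM_pointP MS) => [x y z SE _ | a' b' d' nzv SE norm'].
  by move: PS; rewrite SE (negPf (no_affine _ _ _)).
move: PS SQ; rewrite SE => PS SQ.
have /eqP := infinite_line_direction (nzv := direction_neq0 a 0) norm' PS.
rewrite expr1n mul1r.
rewrite addr_eq0 eq_sym eqr_oppLR => /eqP b'E.
move: SQ; rewrite line_sym => /(affine_line_direction nz_alpha)[_ /eqP].
(* The second factor is the Frobenius image of [1 + a ^+ 2], hence nonzero; so [a'] and then [b']
   vanish, which leaves only the apex, already excluded. *)
have -> : a' ^+ 2 + b' ^+ 2 = a' ^+ 2 * (1 + (a ^+ q) ^+ 2) by rewrite b'E; ring.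
rewrite mulf_eq0 sqrf_eq0 => /orP[/eqP a'0 | ].
  by rewrite b'E a'0 mulr0 oppr0 eqxx.
rewrite exprAC -[1](expr1n _ q) -frobD expf_eq0 q_gt0 /= addrC addr_eq0.
by rewrite (negPf nza2).
Qed.

End BM.

(* GF(q^2) is a finite field F with q ^ 2 elements; its subfield GF(q) is the
   set of the x with x ^+ q = x. *)
Theorem theorem4p2 (q : nat) (F : finFieldType) (alpha beta : F)
    (q_pp : prime_power q) (q_mod4 : q = 1 %[mod 4])
    (cardF : #|F| = (q ^ 2)%N)
    (alpha_neq0 : alpha != 0)
    (beta_notin_GFq : beta ^+ q != beta)
    (nondeg : 4 * alpha ^+ (q + 1) + (beta ^+ q - beta) ^+ 2 != 0) :
  connected_graph (collinearity (BM_variety q alpha beta)) /\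
  is_diameter (collinearity (BM_variety q alpha beta)) 3.
Proof.
have step (P Q : {P | P \in BM_variety q alpha beta}) :
    line (val P) (val Q) \subset BM_variety q alpha beta ->
  (P == Q) || collinearity (BM_variety q alpha beta) P Q.
  by rewrite /collinearity => ->; rewrite andbT orbN.
apply: diameter3 => [[P MP] [Q MQ] | ].
  have [X [Y [PX XY YQ]]] := BM_three_lines q_pp q_mod4 cardF beta_notin_GFq MP MQ.
  have MX := subsetP XY _ (mem_line_l X Y).
  have MY := subsetP YQ _ (mem_line_l Y Q).
  by exists (Sub X MX), (Sub Y MY); split; apply: step.
have [P [Q [MP MQ neqPQ notPQ no2]]] :=
  BM_far_points beta q_pp q_mod4 cardF alpha_neq0.
exists (Sub P MP), (Sub Q MQ); split=> //.
  by rewrite negb_and notPQ orbT.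
case=> S MS; apply: contra (no2 S MS) => /andP[/andP[_ PS] /andP[_ SQ]].
exact/andP.
Qed.
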